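(* For $n\ge 1$ let $t_n(u)=\sum_{D}u^{\operatorname{des}(D)}$, where the sum is over all strongly connected tournaments $D$ on the vertex set $[n]=\{1,\dots,n\}$. Then for every $n\ge1$, \[ t_n(u) = (1+u)^{\binom{n}{2}} - \sum_{k=1}^{n-1} \binom{n}{k}_{u} (1+u)^{\binom{n-k}{2}}\, t_k(u),\] where $\binom{n}{k}_u$ denotes the Gaussian binomial coefficient in the variable $u$.
   Context: A digraph on a finite set $V$ of integers is a set of ordered pairs $(s,t)\in V\times V$ with $s\ne t$ (no loops). A tournament is a digraph with exactly one of $(s,t)$, $(t,s)$ as an edge for each pair $s\neq t$. A digraph is strongly connected if for every two vertices $a,b$ there is a directed path from $a$ to $b$ (the empty path allowed when $a=b$). A descent of a digraph is an edge $(s,t)$ with $s>t$; $\operatorname{des}(D)$ is the number of descents of $D$. The $q$-factorial is $n!_q=\prod_{j=1}^n(1+q+\cdots+q^{j-1})$ and $\binom{n}{k}_q=\frac{n!_q}{k!_q(n-k)!_q}$. *)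

(* Defs.v *)
From HB Require Import structures.
From mathcomp Require Import all_boot all_order all_algebra ring.
Set Implicit Arguments.
Unset Strict Implicit.
Unset Printing Implicit Defensive.
Import GRing.Theory.
Local Open Scope ring_scope.

Section Digraphs.
Variable n : nat.

(* The vertex set {1, ..., n} is rendered as 'I_n = {0, ..., n - 1}; only the
   order of the labels matters for descents. *)
Implicit Type D : {set 'I_n * 'I_n}.

Definition is_digraph D : bool := [forall e in D, e.1 != e.2].

Definition is_tournament D : bool :=
  is_digraph D &&
  [forall s, forall t, (s != t) ==> (((s, t) \in D) (+) ((t, s) \in D))].

Definition edge D : rel 'I_n := fun s t => (s, t) \in D.

Definition strongly_connected D : bool :=
  [forall a, forall b, connect (edge D) a b].

Definition des D : nat := #|[set e in D | (e.2 < e.1)%N]|.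

End Digraphs.

Definition sc_tournament_poly (n : nat) : {poly int} :=
  \sum_(D : {set 'I_n * 'I_n} | is_tournament D && strongly_connected D)
     'X^(des D).

Definition qfact (n : nat) : {poly int} :=
  \prod_(1 <= j < n.+1) \sum_(0 <= i < j) 'X^i.

(* The divisor is monic and, for k <= n, the division is exact: see qbinomK. *)
Definition qbinom (n k : nat) : {poly int} :=
  qfact n %/ (qfact k * qfact (n - k)).

Lemma qfactS n : qfact n.+1 = qfact n * \sum_(0 <= i < n.+1) 'X^i.
Proof. by rewrite /qfact big_nat_recr. Qed.

Lemma qfact_monic n : qfact n \is monic.
Proof.
elim: n => [|n IHn]; first by rewrite /qfact big_geq // monic1.
rewrite qfactS rpredM //.
suff -> : \sum_(0 <= i < n.+1) 'X^i = \poly_(i < n.+1) (1 : int).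
  by rewrite monicE lead_coef_poly // oner_neq0.
by rewrite poly_def big_mkord; apply: eq_bigr => i _; rewrite scale1r.
Qed.

Lemma qfact_dvd n k : (k <= n)%N ->
  exists g : {poly int}, qfact n = g * (qfact k * qfact (n - k)).
Proof.
elim: n k => [|n IHn] [|k] le_kn.
- by exists 1; rewrite /qfact !big_geq // !mulr1.
- by [].
- by exists 1; rewrite mul1r subn0 {2}/qfact big_geq // mul1r.
rewrite subSS; have [g Dg] := IHn k le_kn.
have split_sum : \sum_(0 <= i < n.+1) 'X^i =
    \sum_(0 <= i < k.+1) 'X^i + 'X^(k.+1) * \sum_(0 <= i < n - k) 'X^i
    :> {poly int}.
  rewrite (@big_cat_nat _ _ _ k.+1) //=; congr (_ + _).
  rewrite -{1}[k.+1]add0n big_addn subSS big_distrr /=.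
  by apply: eq_bigr => i _; rewrite -exprD addnC.
rewrite qfactS split_sum mulrDr {1}Dg.
have [lt_kn | le_nk] := ltnP k n; last first.
  have -> : (n - k)%N = 0%N by apply/eqP; rewrite subn_eq0.
  exists g; rewrite [\sum_(0 <= i < 0) _]big_geq // !mulr0 addr0.
  have -> : k = n by apply/eqP; rewrite eqn_leq -ltnS le_kn.
  by rewrite qfactS; ring.
have [h Dh] := IHn k.+1 lt_kn.
exists (g + 'X^(k.+1) * h); rewrite {1}Dh mulrDl qfactS.
have -> : (n - k = (n - k.+1).+1)%N by rewrite -subSn.
rewrite !qfactS; set a := qfact k; set b := qfact (n - k.+1).
set x := \sum_(0 <= i < k.+1) _; set y := \sum_(0 <= i < _.+1) _.
by ring.
Qed.

Lemma qbinomK n k : (k <= n)%N ->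
  qbinom n k * (qfact k * qfact (n - k)) = qfact n.
Proof.
move=> /qfact_dvd[g Dg]; rewrite /qbinom Dg.
by rewrite Pdiv.IdomainMonic.mulpK // rpredM // qfact_monic.
Qed.

(* Main.v *)
(* In a tournament D the vertices that reach every vertex form its source strong
   component: the unique nonempty A such that D is strongly connected on A and
   every edge between A and its complement leaves A.  Conversely, given A with
   k elements, D amounts to a strongly connected tournament on A together with
   an arbitrary tournament on the complement, and relabelling these vertex sets
   increasingly preserves descents; the edges leaving A contribute the inversions
   of A, whose generating function over all k-subsets is the Gaussian binomial.
   Summing over A counts all tournaments, hence gives (1 + u)^C(n, 2). *)
Require Import Defs.
From mathcomp Require Import all_boot all_order all_algebra.
From mathcomp Require Import zify ring.
Set Implicit Arguments.
Unset Strict Implicit.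
Unset Printing Implicit Defensive.
Import GRing.Theory.
Local Open Scope ring_scope.

(** This is the binomial theorem, once the subsets of [Q] are grouped by cardinality. *)
Lemma sum_X_subset (T : finType) (Q : {set T}) :
  \sum_(B : {set T} | B \subset Q) 'X^#|B| = (1 + 'X) ^+ #|Q| :> {poly int}.
Proof.
rewrite addrC exprDn (partition_big (fun B : {set T} => inord #|B| : 'I_#|Q|.+1) predT) //=.
(* [exprDn] attaches the power [#|Q| - i] of ['X] to the index [i]; reversal makes the index the
   cardinality. *)
rewrite [RHS](reindex_inj rev_ord_inj) /=; apply: eq_bigr => i _.
rewrite expr1n mulr1 subSS subKn -1?ltnS // bin_sub -1?ltnS //.
rewrite -cards_draws -sumr_const.
apply: eq_big => [B | B /andP[sBQ /eqP <-]]; last first.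
  by rewrite inordK ?ltnS ?subset_leq_card.
rewrite inE; case sBQ: (B \subset Q) => //=.
by rewrite -val_eqE /= inordK ?ltnS ?subset_leq_card.
Qed.

(** * Tournaments on a vertex subset and source components *)

Section RelativeTournaments.
Variable n : nat.
Implicit Types (A : {set 'I_n}) (D : {set 'I_n * 'I_n}).

(** Edges remain pairs over ['I_n], so that tournaments on complementary vertex sets can be united
    without relabelling. *)
Definition tournament_on A D : bool :=
  [&& D \subset setX A A, [forall s, (s, s) \notin D] &
      [forall s in A, forall t in A,
         (s != t) ==> (((s, t) \in D) (+) ((t, s) \in D))]].

(** Paths are those of [D] and could leave [A]; where paths inside [A] are meant, [D] is contained
    in [setX A A]. *)
Definition strong_on A D : bool :=
  [forall a in A, forall b in A, connect (edge D) a b].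

Definition reaches_all D : {set 'I_n} := [set a | [forall b, connect (edge D) a b]].

Definition source_component D A : bool :=
  [&& A != set0, setX A (~: A) \subset D & strong_on A (D :&: setX A A)].

Lemma tournament_onP A D :
  reflect [/\ forall s t, (s, t) \in D -> s \in A /\ t \in A,
              forall s, (s, s) \notin D &
              forall s t, s \in A -> t \in A -> s != t ->
                ((s, t) \in D) = ((t, s) \notin D)]
          (tournament_on A D).
Proof.
apply: (iffP and3P) => [[/subsetP sDA /forallP irrD /forall_inP totD] | [sDA irrD totD]].
  split=> // [s t /sDA|s t As At neq_st]; first by rewrite in_setX => /andP.
  have /forall_inP/(_ t At)/implyP/(_ neq_st) := totD s As.
  by case: (_ \in D); case: (_ \in D).
split; last 1 first.
- apply/forall_inP=> s As; apply/forall_inP=> t At; apply/implyP=> neq_st.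
  by rewrite (totD s t) //; case: (_ \in D).
- by apply/subsetP=> -[s t] /sDA[As At]; rewrite in_setX As.
- exact/forallP.
Qed.

Lemma strong_onP A D :
  reflect {in A &, forall a b, connect (edge D) a b} (strong_on A D).
Proof.
apply: (iffP forall_inP) => [strD a b Aa Ab | strD a Aa].
  exact: (forall_inP (strD a Aa)).
by apply/forall_inP=> b; apply: strD.
Qed.

Lemma is_tournamentE D : is_tournament D = tournament_on setT D.
Proof.
apply/andP/tournament_onP => [[/forall_inP loopless /forallP tot] | [_ irrD totD]].
  split=> // [s|s t _ _ neq_st].
    by apply/negP=> /loopless; rewrite eqxx.
  have /forallP/(_ t)/implyP/(_ neq_st) := tot s.
  by case: (_ \in D); case: (_ \in D).
split.
  apply/forall_inP=> -[s t] /= Dst; apply: contraTneq Dst => ->; exact: irrD.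
apply/forallP=> s; apply/forallP=> t; apply/implyP=> neq_st.
by rewrite (totD s t) ?inE //; case: (_ \in D).
Qed.

Lemma strongly_connectedE D : strongly_connected D = strong_on setT D.
Proof.
apply/forallP/strong_onP => [strD a b _ _ | strD a]; first exact: (forallP (strD a)).
by apply/forallP=> b; apply: strD; rewrite inE.
Qed.

(** The set [reaches_all D] is closed under predecessors, so no edge enters it and a path between
    two of its vertices never leaves it. *)
Lemma reaches_all_source D :
  (0 < n)%N -> is_tournament D -> source_component D (reaches_all D).
Proof.
move=> n_gt0; rewrite is_tournamentE => /tournament_onP[_ irrD totD].
set A := reaches_all D.
have clA a b : b \in A -> connect (edge D) a b -> a \in A.
  rewrite !inE => /forallP reach_b ab; apply/forallP=> c.
  exact: connect_trans ab (reach_b c).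
apply/and3P; split.
- (* A vertex a of maximal reach is in A: a vertex b not reached by a would
     have an edge to a, hence strictly larger reach. *)
  pose reach a := #|connect (edge D) a|.
  have [a _ max_a] := @arg_maxnP _ (Ordinal n_gt0) xpredT reach isT.
  apply/set0Pn; exists a; rewrite inE; apply/forallP=> b; apply/negPn/negP=> nab.
  have neq_ba : b != a by apply: contraNneq nab => ->; exact: connect0.
  have Dba : (b, a) \in D.
    rewrite (totD b a) ?inE //; apply: contra nab => Dab; exact: connect1.
  have := max_a b isT; rewrite /= /reach leqNgt => /negP; apply.
  apply: proper_card; apply/properP; split.
    by apply/subsetP=> c; apply: connect_trans; apply: connect1.
  by exists b => //; exact: connect0.
- apply/subsetP=> -[a b]; rewrite in_setX in_setC => /andP[Aa nAb].
  have neq_ab : a != b by apply: contraNneq nAb => <-.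
  rewrite (totD a b) ?in_setT //; apply: contra nAb => Dba.
  by apply: clA Aa _; apply: connect1.
apply/strong_onP=> a b Aa Ab.
have: connect (edge D) a b by move: Aa; rewrite inE => /forallP.
case/connectP=> p; elim: p a Aa => [|c p IHp] a Aa /=.
  by move=> _ ->; apply: connect0.
case/andP=> Dac pathp Db.
have Ac : c \in A by apply: (clA c b) => //; apply/connectP; exists p.
apply: (connect_trans _ (IHp c Ac pathp Db)); apply: connect1.
by rewrite /edge in_setI in_setX Aa Ac !andbT.
Qed.

(** A vertex of [A] reaches the rest of [A] inside [A] and the complement by one edge. Conversely,
    no edge enters [A], so every vertex on a path ending in [A] lies in [A]. *)
Lemma source_component_uniq D A :
  is_tournament D -> source_component D A -> A = reaches_all D.
Proof.
rewrite is_tournamentE => /tournament_onP[_ _ totD].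
case/and3P=> /set0Pn[r Ar] /subsetP outA /strong_onP strA.
apply/setP=> a; rewrite inE; apply/idP/forallP => [Aa b | reach_a].
  have [Ab | nAb] := boolP (b \in A).
    apply: connect_sub (strA a b Aa Ab) => x y; rewrite /edge in_setI => /andP[Dxy _].
    exact: connect1.
  by apply: connect1; apply: outA; rewrite in_setX in_setC Aa.
have [p + Dr] := connectP (reach_a r).
elim: p a {reach_a} Dr => [|c p IHp] a /=; first by move=> <-.
move=> Dr /andP[Dac /(IHp c Dr) Ac]; apply: contraLR Dac => nAa.
have neq_ac : a != c by apply: contraNneq nAa => ->.
by rewrite /edge (totD a c) ?in_setT // negbK outA // in_setX in_setC Ac.
Qed.

(** Swapping coordinates matches descending with ascending pairs, and the diagonal supplies the
    remaining [#|A|] elements of [setX A A]. *)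
Lemma card_descending_pairs A :
  #|[set e in setX A A | (e.2 < e.1)%N]| = 'C(#|A|, 2).
Proof.
set Q := [set e in _ | _].
pose Q' := [set e in setX A A | (e.1 < e.2)%N].
pose I := [set e in setX A A | e.1 == e.2].
have cI : #|I| = #|A|.
  have -> : I = [set (x, x) | x in A].
    apply/setP=> -[x y]; rewrite !inE /=; apply/andP/imsetP => [[/andP[Ax _] /eqP <-]|].
      by exists x.
    by case=> z Az [-> ->]; rewrite Az eqxx.
  by apply: card_imset => x y [].
have cQ' : #|Q'| = #|Q|.
  have -> : Q = [set (e.2, e.1) | e in Q'].
    apply/setP=> -[x y]; apply/idP/imsetP => [| [[x' y'] + [-> ->]]].
      by rewrite !inE /= => H; exists (y, x); rewrite // !inE /= [(y \in A) && _]andbC.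
    by rewrite !inE /= [(y' \in A) && _]andbC.
  by rewrite card_imset // => -[x y] [x' y'] [-> ->].
have : #|setX A A| = (#|Q| + #|Q'| + #|I|)%N.
  have -> : setX A A = (Q :|: Q') :|: I.
    apply/setP=> -[x y]; rewrite !inE /= -!andb_orr -val_eqE /=.
    by case: ltngtP; rewrite andbT.
  have -> : #|(Q :|: Q') :|: I| = (#|Q :|: Q'| + #|I|)%N.
    rewrite -cardsUI.
    suff -> : (Q :|: Q') :&: I = set0 by rewrite cards0 addn0.
    apply/setP=> -[x y]; rewrite !inE /= -val_eqE /=.
    by case: ltngtP; rewrite !(andbT, andbF).
  congr (_ + _)%N; rewrite -cardsUI.
  suff -> : Q :&: Q' = set0 by rewrite cards0 addn0.
  by apply/setP=> -[x y]; rewrite !inE /=; case: ltngtP; rewrite !(andbT, andbF).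
rewrite cardsX cQ' cI bin2 => cAA.
have -> : (#|A| * #|A|.-1 = #|Q| + #|Q|)%N by rewrite -subn1 mulnBr muln1 cAA addnK.
by rewrite addnn doubleK.
Qed.

End RelativeTournaments.

(** * Generating functions of tournaments by descents *)

Section Sums.
Variable n : nat.
Implicit Types (A : {set 'I_n}) (D : {set 'I_n * 'I_n}).

(* A tournament on A is determined by its set of descents, which is arbitrary. *)
Lemma sum_tournament_on A :
  \sum_(D | tournament_on A D) 'X^(des D) = (1 + 'X) ^+ 'C(#|A|, 2) :> {poly int}.
Proof.
rewrite -card_descending_pairs; set Q := [set e in _ | _].
rewrite -sum_X_subset.
pose descents D := [set e in D | (e.2 < e.1)%N].
(* An ascending pair of [A] becomes an edge exactly when its reversal is not among the chosen
   descents. *)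
pose completion D := D :|: [set e in setX A A | (e.1 < e.2)%N && ((e.2, e.1) \notin D)].
rewrite (reindex_onto completion descents) /=; last first.
  move=> D /tournament_onP[sDA irrD totD]; apply/setP=> -[s t]; rewrite !inE /=.
  apply/idP/idP => [|Dst].
    case/orP=> [/andP[]//|/andP[/andP[As At] /andP[lt_st]]].
    by rewrite lt_st andbT -totD // -val_eqE ltn_eqF.
  have [As At] := sDA s t Dst; rewrite Dst As At /=.
  case: ltngtP => [lt_st|lt_ts|/val_inj eq_st] //=.
    by rewrite andbT -totD // -val_eqE ltn_eqF.
  by move: Dst; rewrite eq_st (negPf (irrD _)).
apply: eq_big => [B | B /andP[_ /eqP DB]]; last by rewrite -[in RHS]DB.
apply/andP/idP => [[/tournament_onP[sBA _ _] /eqP <-]|/subsetP sBQ].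
  apply/subsetP=> -[s t]; rewrite !inE => /andP[Bst ->] /=; rewrite andbT.
  by apply/andP; apply: sBA; rewrite !inE.
have BQ s t : (s, t) \in B -> [/\ s \in A, t \in A & (t < s)%N].
  by move/sBQ; rewrite !inE /= => /andP[/andP[-> ->] ->].
split; last first.
  apply/eqP/setP=> -[s t]; rewrite !inE /=; apply/andP/idP => [[]|Bst].
    by case: ltngtP => //; rewrite ?andbF ?orbF.
  by rewrite Bst; case: (BQ s t Bst).
apply/tournament_onP; split=> [s t|s|s t As At neq_st].
- by rewrite !inE => /orP[/BQ[]|/andP[/andP[]]].
- rewrite !inE /= ltnn andbF orbF; apply/negP=> /BQ[_ _]; by rewrite ltnn.
rewrite !inE /= As At /=.
have nB (x y : 'I_n) : (x < y)%N -> (x, y) \in B = false.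
  by move=> lt_xy; apply/negP=> /BQ[_ _]; rewrite ltnNge ltnW.
case: ltngtP => [lt_st|lt_ts|/val_inj eq_st].
- by rewrite (nB s t) //= orbF.
- by rewrite (nB t s) //= orbF negbK.
- by rewrite eq_st eqxx in neq_st.
Qed.

(** Edges of the image join only images of vertices, whose preimages are unique, so paths lift step
    by step. *)
Lemma connect_image k (f : 'I_k -> 'I_n) (E : {set 'I_k * 'I_k}) i j : injective f ->
  connect (edge [set (f e.1, f e.2) | e in E]) (f i) (f j) = connect (edge E) i j.
Proof.
move=> f_inj; set D := [set _ | _ in _].
have edgeD x y : edge D x y -> exists2 e, e \in E & x = f e.1 /\ y = f e.2.
  by case/imsetP=> e Ee [-> ->]; exists e.
have edgeDf x y : edge D (f x) (f y) = edge E x y.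
  apply/idP/idP => [/edgeD[[x' y'] Exy [/f_inj -> /f_inj ->]] //|Exy].
  by apply/imsetP; exists (x, y).
apply/connectP/connectP => -[p].
  elim: p i => [|y p IHp] i /=; first by move=> _ /f_inj ->; exists [::].
  case/andP=> Diy; have [[x' y'] _ /= [_ def_y]] := edgeD _ _ Diy.
  rewrite def_y in Diy *; move=> /IHp H /H[q pathq ->].
  by exists (y' :: q) => //=; rewrite -edgeDf Diy.
elim: p i => [|y p IHp] i /=; first by move=> _ ->; exists [::].
case/andP=> Eiy /IHp H /H[q pathq ->].
by exists (f y :: q) => //=; rewrite edgeDf Eiy.
Qed.

(** Relabelling along an increasing [f] is a bijection between digraphs on ['I_k] and digraphs on
    the image that respects tournaments, strong connectivity and descents. *)
Lemma sum_strong_on_image k (f : 'I_k -> 'I_n) (A := f @: setT) :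
    (forall i j, (f i < f j)%N = (i < j)%N) ->
  \sum_(D | tournament_on A D && strong_on A D) 'X^(des D) = sc_tournament_poly k.
Proof.
move=> f_mono.
have f_inj : injective f.
  move=> i j Dij; apply: val_inj; apply/eqP; rewrite eqn_leq leqNgt -f_mono Dij ltnn.
  by rewrite leqNgt -f_mono Dij ltnn.
pose h (E : {set 'I_k * 'I_k}) := [set (f e.1, f e.2) | e in E].
pose h' D := [set e : 'I_k * 'I_k | (f e.1, f e.2) \in D].
have Af i : f i \in A by apply: imset_f; rewrite inE.
have hE E i j : ((f i, f j) \in h E) = ((i, j) \in E).
  apply/imsetP/idP => [[[x y] Exy [/f_inj -> /f_inj ->]] //|Eij].
  by exists (i, j).
rewrite (reindex_onto h h') /=; last first.
  move=> D /andP[/tournament_onP[sDA _ _] _]; apply/setP=> -[s t].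
  apply/imsetP/idP => [[[x y]] | Dst]; first by rewrite inE /= => Dxy [-> ->].
  have [/imsetP[x _ Ds] /imsetP[y _ Dt]] := sDA s t Dst.
  by exists (x, y); rewrite ?inE /= -?Ds -?Dt.
apply: eq_big => [E | E _]; last first.
  congr ('X^_); rewrite /des -(card_imset _ (_ : injective (fun e => (f e.1, f e.2)))); last first.
    by move=> [x y] [x' y'] [/f_inj -> /f_inj ->].
  apply: eq_card => -[s t]; rewrite inE /=; apply/andP/imsetP.
    case=> /imsetP[[x y] Exy [-> ->]]; rewrite f_mono => lt_yx.
    by exists (x, y); rewrite // inE Exy.
  case=> -[x y]; rewrite inE /= => /andP[Exy lt_yx] [-> ->].
  by rewrite f_mono hE.
have -> : (h' (h E) == E) = true by apply/eqP/setP=> -[i j]; rewrite inE hE.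
rewrite andbT is_tournamentE strongly_connectedE; congr (_ && _).
  apply/tournament_onP/tournament_onP => [[_ irr tot]|[_ irr tot]].
    split=> [//|i|i j _ _ neq_ij]; first by rewrite -hE.
    by rewrite -!hE tot // inj_eq.
  split.
  - by move=> s t /imsetP[[i j] _ [-> ->]].
  - move=> s; apply/negP=> Ess; have /imsetP[[i j] _ [Ds _]] := Ess.
    by move: Ess; rewrite Ds hE; apply/negP.
  by move=> _ _ /imsetP[i _ ->] /imsetP[j _ ->]; rewrite inj_eq // !hE; apply: tot.
apply/strong_onP/strong_onP => [str i j _ _|str _ _ /imsetP[i _ ->] /imsetP[j _ ->]].
  by rewrite -(connect_image _ _ _ f_inj); apply: str.
by rewrite connect_image //; apply: str.
Qed.

Lemma des_disjointU D1 D2 :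
  [disjoint D1 & D2] -> des (D1 :|: D2) = (des D1 + des D2)%N.
Proof.
move=> dis12; rewrite /des -cardsUI.
have -> : [set e in D1 | (e.2 < e.1)%N] :&: [set e in D2 | (e.2 < e.1)%N] = set0.
  apply/setP=> e; rewrite !inE; apply/negP=> /andP[/andP[D1e _] /andP[D2e _]].
  by have := disjointFr dis12 D1e; rewrite D2e.
by rewrite cards0 addn0; apply: eq_card => e; rewrite !inE andb_orl.
Qed.

Lemma sum_strong_on A :
  \sum_(D | tournament_on A D && strong_on A D) 'X^(des D) = sc_tournament_poly #|A|.
Proof.
(* Descents survive only under an increasing enumeration, hence the order-theoretic one. *)
pose f : 'I_#|A| -> 'I_n := @Order.enum_val _ _ A.
have f_mono i j : (f i < f j)%N = (i < j)%N.
  have le_total : total (<=%O : rel 'I_n) by move=> x y; exact: leq_total.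
  have := @Order.le_enum_val _ _ le_total A i j; rewrite !leEord => f_le.
  have := @Order.le_enum_val _ _ le_total A j i; rewrite !leEord => f_le'.
  by rewrite !ltnNge f_le'.
have {1 2}-> : A = f @: setT; last exact: sum_strong_on_image.
apply/setP=> x; apply/idP/imsetP => [Ax|[i _ ->]]; last exact: Order.enum_valP.
by exists (Order.enum_rank_in Ax x) => //; rewrite /f Order.enum_rankK_in.
Qed.

(** Each [D] is the disjoint union of a strongly connected tournament on [A], an arbitrary
    tournament on [~: A] and all of [setX A (~: A)]. Descents add up, so the sum factors. *)
Lemma sum_source_component A : A != set0 ->
  \sum_(D | is_tournament D && source_component D A) 'X^(des D)
    = 'X^(des (setX A (~: A))) * sc_tournament_poly #|A| * (1 + 'X) ^+ 'C(n - #|A|, 2).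
Proof.
move=> A_n0; set K := setX A (~: A).
have <- : #|~: A| = (n - #|A|)%N by rewrite cardsCs setCK card_ord.
rewrite -sum_strong_on -sum_tournament_on -mulrA big_distrlr big_distrr /=.
under [RHS]eq_bigr do rewrite big_distrr /=.
rewrite pair_big /=.
pose h (p : {set 'I_n * 'I_n} * {set 'I_n * 'I_n}) := p.1 :|: p.2 :|: K.
pose h' D := (D :&: setX A A, D :&: setX (~: A) (~: A)).
rewrite (reindex_onto h h') /=; last first.
  move=> D; rewrite is_tournamentE => /andP[/tournament_onP[_ irrD totD]].
  case/and3P=> _ /subsetP sKD _; apply/setP=> -[s t].
  have Kst := sKD (s, t); have Kts := sKD (t, s).
  move: Kst Kts; rewrite /K !inE /=.
  case: (boolP (s \in A)) => As; case: (boolP (t \in A)) => At //= Kst Kts;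
    rewrite ?(andbT, andbF, orbF, orbT) //.
    by rewrite Kst.
  (* An edge from the complement into [A] is impossible, since its reversal is in [K]. *)
  apply/esym; rewrite (totD s t) ?in_setT ?Kts //.
  by apply: contraNneq As => ->.
have hK D1 D2 : tournament_on A D1 -> tournament_on (~: A) D2 ->
    h' (h (D1, D2)) = (D1, D2).
  case/tournament_onP=> sD1 _ _ /tournament_onP[sD2 _ _].
  rewrite /h' /h /=; congr pair; apply/setP=> -[s t]; rewrite /K !inE /=.
    apply/andP/idP => [[+ /andP[As At]]|D1st]; last first.
      by have [-> ->] := sD1 s t D1st; rewrite D1st.
    rewrite As At /= orbF => /orP[//|/sD2[]]; by rewrite inE As.
  apply/andP/idP => [[+ /andP[nAs nAt]]|D2st]; last first.
    by have [] := sD2 s t D2st; rewrite !inE D2st orbT => -> ->.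
  rewrite (negPf nAs) /= orbF => /orP[/sD1[]|//]; by rewrite (negPf nAs).
apply: eq_big => [[D1 D2] | [D1 D2]] /=; last first.
  case/andP=> _ /eqP Dh.
  (* The reindexing condition says that restriction gives back [D1] and [D2], which confines them to
     their blocks. *)
  have sD1 : D1 \subset setX A A by case: Dh => <- _; apply: subsetIr.
  have sD2 : D2 \subset setX (~: A) (~: A) by case: Dh => _ <-; apply: subsetIr.
  have dis12 : [disjoint D1 & D2].
    rewrite -setI_eq0 -subset0; apply: subset_trans (setISS sD1 sD2) _.
    by apply/subsetP=> -[s t]; rewrite !inE /=; case: (s \in A); rewrite ?andbF.
  have disK : [disjoint D1 :|: D2 & K].
    rewrite -setI_eq0 -subset0; apply: subset_trans (setSI _ (setUSS sD1 sD2)) _.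
    apply/subsetP=> -[s t]; rewrite !inE /=.
    by case: (s \in A); case: (t \in A).
  by rewrite /h !des_disjointU //= -!exprD addnC.
apply/idP/idP => [/andP[/andP[+ srcA] /eqP Dh]|/andP[/andP[tD1 str1] tD2]].
  rewrite is_tournamentE => /tournament_onP[_ irrD totD].
  have {srcA}/and3P[_ _] := srcA.
  have [D1E D2E] : h (D1, D2) :&: setX A A = D1 /\ h (D1, D2) :&: setX (~: A) (~: A) = D2.
    by case: Dh.
  rewrite D1E => ->; rewrite andbT.
  have tournI B : tournament_on B (h (D1, D2) :&: setX B B).
    apply/tournament_onP; split=> [s t|s|s t Bs Bt neq_st].
    - by rewrite !inE => /and3P[].
    - by rewrite in_setI (negPf (irrD s)).
    by rewrite !in_setI !in_setX Bs Bt !andbT totD ?inE.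
  by rewrite -{1}D1E -{2}D2E !tournI.
rewrite hK // eqxx andbT.
have /(congr1 fst) /= Dh1 := hK _ _ tD1 tD2.
apply/andP; split; last first.
  by apply/and3P; split; rewrite // ?subsetUr // Dh1.
have /tournament_onP[sD1 irr1 tot1] := tD1; have /tournament_onP[sD2 irr2 tot2] := tD2.
rewrite is_tournamentE; apply/tournament_onP; split=> [s t||s t _ _ neq_st].
- by rewrite !inE.
- move=> s; rewrite /h /K !inE /= (negPf (irr1 s)) (negPf (irr2 s)) /=.
  by case: (s \in A).
(* With the confinement written into each membership, the terms of the wrong block vanish in the
   case split on [s] and [t]. *)
have D1A x y : (x, y) \in D1 = [&& x \in A, y \in A & (x, y) \in D1].
  by apply/idP/and3P => [Dxy|[]//]; have [-> ->] := sD1 _ _ Dxy.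
have D2A x y : (x, y) \in D2 = [&& x \notin A, y \notin A & (x, y) \in D2].
  by apply/idP/and3P => [Dxy|[]//]; have [] := sD2 _ _ Dxy; rewrite !inE.
rewrite /h /K !inE /= (D1A s) (D2A s) (D1A t) (D2A t).
case: (boolP (s \in A)) => As; case: (boolP (t \in A)) => At //=; rewrite ?orbF.
- exact: tot1.
- by apply: tot2; rewrite ?inE.
Qed.

(** Tournaments are sorted by their value of [reaches_all]. At [n = 0] the left side is 1, while no
    nonempty [A] exists. *)
Lemma sum_tournaments : (0 < n)%N ->
  (1 + 'X) ^+ 'C(n, 2) =
  \sum_(A : {set 'I_n} | A != set0)
     'X^(des (setX A (~: A))) * sc_tournament_poly #|A| * (1 + 'X) ^+ 'C(n - #|A|, 2).
Proof.
move=> n_gt0; have {1}-> : n = #|[set: 'I_n]| by rewrite cardsT card_ord.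
rewrite -sum_tournament_on.
under [LHS]eq_bigl do rewrite -is_tournamentE.
rewrite (partition_big (@reaches_all n) (fun A => A != set0)) /=; last first.
  by move=> D /(reaches_all_source n_gt0)/and3P[].
apply: eq_bigr => A A_n0; rewrite -sum_source_component //; apply: eq_bigl => D.
have [tD|//] := boolP (is_tournament D).
apply/eqP/idP => [<-|/(source_component_uniq tD)//]; exact: reaches_all_source.
Qed.

End Sums.

(** * Gaussian binomials as generating functions of inversions *)

Section GaussianBinomial.
Variable n : nat.
Implicit Types (A B : {set 'I_n}).

Definition below (m : nat) : {set 'I_n} := [set i : 'I_n | (i < m)%N].

(** The ground set is an initial segment of the fixed type ['I_n], so induction on [m] does not
    change the type of the sets. *)
Definition inversion_poly (m k : nat) : {poly int} :=
  \sum_(A : {set 'I_n} | (A \subset below m) && (#|A| == k))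
     'X^(des (setX A (below m :\: A))).

Lemma card_below m : (m <= n)%N -> #|below m| = m.
Proof.
move=> le_mn; have w_inj : injective (widen_ord le_mn).
  by move=> i j /(congr1 val) /= /ord_inj.
rewrite -[RHS]card_ord -(card_imset _ w_inj).
apply: eq_card => i; rewrite inE; apply/idP/imsetP => [lt_im|[j _ ->]]; last exact: (ltn_ord j).
by exists (Ordinal lt_im) => //; apply: val_inj.
Qed.

Lemma inversion_poly0 m : inversion_poly m 0 = 1.
Proof.
rewrite /inversion_poly (big_pred1 set0) => [|A]; last first.
  by rewrite cards_eq0 andbC /=; case: eqP => //= ->; rewrite sub0set.
rewrite [des _](_ : _ = 0%N) ?expr0 //; apply/eqP; rewrite cards_eq0.
by apply/eqP/setP=> e; rewrite !inE.
Qed.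

Lemma inversion_poly_gt m k : (m <= n)%N -> (m < k)%N -> inversion_poly m k = 0.
Proof.
move=> le_mn lt_mk; apply: big_pred0 => A; apply/negP=> /andP[/subset_leq_card + /eqP cA].
by rewrite card_below // cA leqNgt lt_mk.
Qed.

(* The first term counts the sets avoiding the largest element m; if m is in A,
   it forms a descent with each of the m - k elements below it outside A. *)
Lemma inversion_polyS m k : (m < n)%N -> (k <= m)%N ->
  inversion_poly m.+1 k.+1 = inversion_poly m k.+1 + 'X^(m - k) * inversion_poly m k.
Proof.
move=> lt_mn le_km; pose x := Ordinal lt_mn.
have x_below : x \notin below m by rewrite inE ltnn.
have belowS : below m.+1 = x |: below m.
  by apply/setP=> i; rewrite !inE -val_eqE /= ltnS leq_eqVlt.
rewrite /inversion_poly (bigID (fun A : {set 'I_n} => x \notin A)) /=; congr (_ + _).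
  apply: eq_big => [A|A /andP[/andP[/subsetP sAm _] _]].
    rewrite andbAC; congr (_ && _); apply/andP/idP => [[]|sAm].
      move=> /subsetP sA xA; apply/subsetP=> i Ai; have := sA i Ai.
      by rewrite belowS in_setU1; case: eqP => // Dx; rewrite -Dx Ai in xA.
    rewrite belowS (subset_trans sAm (subsetUr _ _)); split=> //.
    by apply: contra x_below; apply: (subsetP sAm).
  (* The complement gains [x], which exceeds every element of [A] and so creates no descent. *)
  congr ('X^_); apply: eq_card => -[s t]; rewrite !inE /=.
  have [As|//] := boolP (s \in A).
  have := sAm s As; rewrite inE; case: (t \in A) => //=.
  by lia.
rewrite big_distrr /= (reindex_onto (fun A => x |: A) (fun A => A :\ x)) /=; last first.
  by move=> A /andP[_]; rewrite negbK; apply: setD1K.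
have sub_xU A : x \notin A -> (x |: A \subset below m.+1) = (A \subset below m).
  move=> nAx; rewrite belowS; apply/idP/idP => [/subsetP sA|]; last exact: setUS.
  apply/subsetP=> i Ai; have := sA i; rewrite !in_setU1 Ai orbT => /(_ isT).
  by case: eqP => // Di; rewrite -Di Ai in nAx.
apply: eq_big => [A|A /andP[/andP[/andP[sA /eqP cA] _] /eqP DA]].
  (* If [x] is in [A], both conditions fail: removing [x] does not give [A] back, and [A] is not
     inside [below m]. *)
  rewrite setU11 andbT; have [Ax|nAx] := boolP (x \in A).
    rewrite [A \subset below m](_ : _ = false) ?andbF //=.
      by apply/andP=> -[_ /eqP/setP/(_ x)]; rewrite !inE eqxx Ax.
    by apply/negP=> /subsetP/(_ x Ax); apply/negP.
  by rewrite sub_xU // cardsU1 nAx eqSS setU1K // eqxx andbT.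
have nAx : x \notin A by rewrite -DA !inE eqxx.
rewrite sub_xU // in sA.
rewrite -exprD; congr ('X^_).
have -> : below m.+1 :\: (x |: A) = below m :\: A.
  apply/setP=> i; rewrite belowS !inE -val_eqE /=.
  by case: (ltngtP i m); rewrite ?andbF.
have -> : setX (x |: A) (below m :\: A) =
    setX [set x] (below m :\: A) :|: setX A (below m :\: A).
  by apply/setP=> e; rewrite !inE andb_orl.
rewrite des_disjointU; last first.
  rewrite -setI_eq0; apply/eqP/setP=> -[s t]; rewrite !inE /=.
  by case: eqP => //= ->; rewrite (negPf nAx) !andbF.
congr (_ + _)%N; rewrite /des.
have -> : [set e in setX [set x] (below m :\: A) | (e.2 < e.1)%N] =
    setX [set x] (below m :\: A).
  apply/setP=> -[s t]; rewrite !inE /=; case: eqP => //= ->.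
  by rewrite -andbA andbb.
rewrite cardsX cards1 mul1n cardsD (setIidPr sA) card_below ?(ltnW lt_mn) //.
by move: cA; rewrite cardsU1 nAx add1n => -[->].
Qed.

(** Write [j] for 1 + q + ... + q^(j-1). By induction on [m], the two terms of the q-Pascal rule
    [inversion_polyS] yield the two parts of [m+1] = [m-k] + q^(m-k) [k+1], each times [qfact m]. *)
Lemma inversion_poly_fact m k : (m <= n)%N -> (k <= m)%N ->
  inversion_poly m k * (qfact k * qfact (m - k)) = qfact m.
Proof.
have fact0 : qfact 0 = 1 by rewrite /qfact big_geq.
elim: m k => [|m IHm] [|k] // lt_mn le_km; rewrite ?inversion_poly0 ?fact0 ?mul1r //.
rewrite ltnS in le_km; rewrite subSS inversion_polyS // [qfact m.+1]qfactS.
have -> : \sum_(0 <= i < m.+1) 'X^i =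
    \sum_(0 <= i < m - k) 'X^i + 'X^(m - k) * \sum_(0 <= i < k.+1) 'X^i
    :> {poly int}.
  rewrite (@big_cat_nat _ _ _ (m - k)) //=; last by rewrite leqW ?leq_subr.
  congr (_ + _); rewrite -{1}[(m - k)%N]add0n big_addn.
  have -> : (m.+1 - (m - k) = k.+1)%N by lia.
  by rewrite big_distrr /=; apply: eq_bigr => i _; rewrite -exprD addnC.
have IHk := IHm k (ltnW lt_mn) le_km.
rewrite mulrDr -{2}IHk (qfactS k).
have [lt_km|le_mk] := ltnP k m; last first.
  have -> : k = m by apply/eqP; rewrite eqn_leq le_km.
  rewrite inversion_poly_gt ?(ltnW lt_mn) // subnn [\sum_(0 <= i < 0) _]big_geq //.
  by ring.
rewrite -(IHm k.+1 (ltnW lt_mn) lt_km) qfactS.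
have -> : (m - k = (m - k.+1).+1)%N by rewrite -subSn.
rewrite !qfactS.
set a := inversion_poly m k.+1; set b := inversion_poly m k.
set c := qfact k; set d := qfact _.
set y := \sum_(0 <= i < k.+1) _; set z := \sum_(0 <= i < _.+1) _.
by ring.
Qed.

(** As [qbinom] is a quotient, both sides are compared after multiplication by its denominator,
    which is monic and therefore cancels. *)
Lemma sum_inversions k : (k <= n)%N ->
  \sum_(A : {set 'I_n} | #|A| == k) 'X^(des (setX A (~: A))) = qbinom n k.
Proof.
move=> le_kn.
have qk_n0 : qfact k * qfact (n - k) != 0.
  by rewrite monic_neq0 // rpredM // qfact_monic.
apply: (mulIf qk_n0); rewrite qbinomK // -(inversion_poly_fact (leqnn n) le_kn).
have belowT : below n = setT by apply/setP=> i; rewrite !inE ltn_ord.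
congr (_ * _); rewrite /inversion_poly belowT; apply: eq_big => [A|A _].
  by rewrite subsetT.
by rewrite setTD.
Qed.

End GaussianBinomial.

(** * The recurrence, by grouping source components by size *)

Theorem theorem3p2 (n : nat) (n_ge1 : (1 <= n)%N) :
  sc_tournament_poly n =
    (1 + 'X) ^+ 'C(n, 2)
    - \sum_(1 <= k < n)
        qbinom n k * (1 + 'X) ^+ 'C(n - k, 2) * sc_tournament_poly k.
Proof.
apply/esym/eqP; rewrite subr_eq; apply/eqP.
pose t k := qbinom n k * (1 + 'X) ^+ 'C(n - k, 2) * sc_tournament_poly k.
(* The isolated [sc_tournament_poly n] is the term [t n], because [qbinom n n] is 1. *)
transitivity (\sum_(1 <= k < n.+1) t k); last first.
  rewrite big_nat_recr //= addrC; congr (_ + _).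
  have qn_n0 : qfact n * qfact (n - n) != 0.
    by rewrite monic_neq0 // rpredM // qfact_monic.
  have qbinomnn : qbinom n n = 1.
    apply: (mulIf qn_n0); rewrite qbinomK // mul1r subnn.
    by rewrite [qfact 0]big_geq // mulr1.
  by rewrite /t qbinomnn subnn expr0 !mul1r.
rewrite sum_tournaments // (@big_nat_widenl _ _ _ _ 0) // big_mkord.
(* Since [#|A|] is at most [n], [inord] keeps its value. *)
rewrite (partition_big (fun A : {set 'I_n} => inord #|A| : 'I_n.+1)
           (fun k : 'I_n.+1 => 0 < k)%N) /=; last first.
  by move=> A; rewrite inordK ?card_gt0 // ltnS -[leqRHS]card_ord max_card.
(* Among the sets of size [k] only the power of ['X] varies, and it sums to the Gaussian
   binomial. *)
apply: eq_bigr => k k_gt0; rewrite /t -sum_inversions -1?ltnS // !big_distrl /=.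
apply: eq_big => [A|A /andP[_ /eqP <-]]; last first.
  rewrite inordK; last by rewrite ltnS -[leqRHS]card_ord max_card.
  by rewrite mulrAC.
rewrite -card_gt0 -val_eqE /= inordK; last by rewrite ltnS -[leqRHS]card_ord max_card.
by case: eqP => [->|]; rewrite ?k_gt0 ?andbF.
Qed.
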